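(* For every pair of oriented knots $K_1, K_2$ in $S^3$, with connected sum $K_1\#K_2$, $$\theta(K_1\#K_2) = N(K_2)\,\theta(K_1) + N(K_1)\,\theta(K_2),$$ where $\theta$ is the Bar-Natan–van der Veen knot invariant and $N(K)=\Delta_1(K)\Delta_2(K)\Delta_3(K)$ is the normalization factor in its definition (both as defined in the context).
   Context: Let $T_1,T_2$ be indeterminates and set $T_3:=T_1T_2$. **Alexander factor.** For a knot $K$ let $\Delta_K(T)$ be the symmetric Alexander polynomial, $\Delta_K(T)=\Delta_K(T^{-1})$, normalized by $\Delta_K(1)=1$. For $\nu=1,2,3$ put $\Delta_\nu(K):=\Delta_K(T_\nu)$, and $N(K):=\Delta_1(K)\Delta_2(K)\Delta_3(K)$. **Upright diagrams.** The knot $K$ is represented by an upright diagram $D$: an oriented long knot diagram (one incoming end at the bottom, one outgoing end at the top, both pointing up) in which at every crossing both strands are oriented upwards. If $D$ has $n$ crossings, its edges (the arcs between consecutive passages through crossings) are labelled $1,\dots,2n+1$ in order along the knot. The rotation number $\varphi_k\in\mathbb{Z}$ of edge $k$ is the signed number of full counterclockwise rotations of its tangent direction (clockwise rotations count negatively). Each crossing is recorded as $c=(s,i,j)$, where $s=\pm1$ is its sign, $i$ is the label of the incoming (lower) edge of the over-strand and $j$ is the label of the incoming (lower) edge of the under-strand; the outgoing edges are then $i+1$ and $j+1$. **Traffic function.** $G=(g_{\alpha\beta})$ is the $(2n+1)\times(2n+1)$ matrix of rational functions in $T$ in which $g_{\alpha\beta}$ is the total traffic measured at edge $\beta$ when a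 unit of traffic is injected at edge $\alpha$; traffic on an under-strand passes through unaffected, while at a crossing of sign $s$ traffic on the over-strand continues with weight $T^s$ and falls to the outgoing edge of the under-strand with weight $1-T^s$. Explicitly, $G$ is the unique solution of: for every crossing $(s,i,j)$ and every $\beta$, $$g_{i\beta}=\delta_{i\beta}+T^s g_{i+1,\beta}+(1-T^s)g_{j+1,\beta},\qquad g_{j\beta}=\delta_{j\beta}+g_{j+1,\beta},$$ and $g_{2n+1,\beta}=\delta_{2n+1,\beta}$, where $\delta$ is the Kronecker delta. For $\nu=1,2,3$, $g_{\nu\alpha\beta}$ denotes $g_{\alpha\beta}$ with $T$ replaced by $T_\nu$. **The functions $F_1,F_2,F_3$.** For crossings $c=(s,i,j)$, $c_0=(s_0,i_0,j_0)$, $c_1=(s_1,i_1,j_1)$ and an edge $k$: $$\begin{aligned} F_1(c) ={}& s\big[\tfrac12 - g_{3ii} +T_2^s g_{1ii}g_{2ji} - T^s_2g_{3jj}g_{2ji} - (T^s_2 - 1)g_{3ii}g_{2ji}\\ & + (T^s_3 -1) g_{2ji}g_{3ji} - g_{1ii}g_{2jj} + 2g_{3ii}g_{2jj} + g_{1ii}g_{3jj} - g_{2ii}g_{3jj}\big]\\ & + \frac{s}{T^s_2 -1}\big[(T^s_1-1)T^s_2 (g_{3jj}g_{1ji} - g_{2jj}g_{1ji} + T^s_2 g_{1ji}g_{2ji})\\ & +(T^s_3-1)(g_{3ji} - T^s_2 g_{1ii}g_{3ji} + g_{2ij}g_{3ji} + (T^s_2 - 2)g_{2jj}g_{3ji})\\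 & -(T^s_1-1)(T^s_2+1)(T^s_3-1)g_{1ji}g_{3ji}\big], \end{aligned}$$ $$F_2(c_0,c_1) = \frac{s_1(T^{s_0}_1-1)(T^{s_1}_3-1)g_{1j_1i_0}g_{3j_0i_1}}{T^{s_1}_2-1}\big(T^{s_0}_2g_{2i_1i_0} + g_{2j_1j_0} - T^{s_0}_2g_{2j_1i_0} - g_{2i_1j_0}\big),$$ $$F_3(\varphi_k,k) = \varphi_k\,(g_{3kk} - \tfrac12).$$ **The invariant $\theta$.** $$\theta(K) := N(K)\Big( \sum_c F_1(c) + \sum_{c_0,c_1} F_2(c_0,c_1) + \sum_k F_3(\varphi_k, k) \Big),$$ where the sums run over all crossings $c$, all ordered pairs of crossings $(c_0,c_1)$ (including $c_0=c_1$), and all edges $k$ of an upright diagram $D$ of $K$. It is a known theorem of Bar-Natan and van der Veen (to be taken as given) that $\theta(K)$ does not depend on the choice of $D$. *)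

(* Defs.v *)
From HB Require Import structures.
From mathcomp Require Import all_boot all_order all_algebra.
From mathcomp Require Import all_classical all_reals all_analysis.

Set Implicit Arguments.
Unset Strict Implicit.
Unset Printing Implicit Defensive.

Import Order.TTheory GRing.Theory Num.Theory.
Import numFieldNormedType.Exports.

Local Open Scope ring_scope.

(* S^1 and S^3 are modelled as the one-point compactifications of R and R^3;
   both are oriented by the standard orientation of R and R^3. *)
Notation circle R := (one_point_compactification R).
Notation sphere3 R := (one_point_compactification 'rV[R]_3).

(* Letting the time of the isotopy range over R instead of [0, 1] is harmless:
   an isotopy over [0, 1] extends by constants. We only use X compact
   Hausdorff, so that each continuous bijection H t is a homeomorphism. *)
Definition isotopic_to_id (R : realType) (X : topologicalType) (h : X -> X) :=
  exists H : R -> X -> X,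
    [/\ continuous (fun p : R * X => H p.1 p.2),
        forall t, bijective (H t), H 0 =1 id & H 1 =1 h].

(* Equivalence of oriented knots: ambient isotopy, up to an
   orientation-preserving reparametrization of the circle. *)
Definition knot_equiv (R : realType) (c c' : circle R -> sphere3 R) :=
  exists (rho : circle R -> circle R) (h : sphere3 R -> sphere3 R),
    [/\ isotopic_to_id R rho, isotopic_to_id R h & h \o c =1 c' \o rho].

Definition point (R : realType) (x y z : R) : 'rV[R]_3 :=
  \row_(j < 3) [:: x; y; z]`_j.

(* The polygonal curve with vertices vs (reached at times 0, 1, 2, ...),
   coming from infinity along the vertical half-line below the first vertex,
   going back to infinity along the vertical half-line above the last one, and
   closed up by the point at infinity. Vertical means along the y-axis. *)
Definition long_polygon (R : realType) (vs : seq 'rV[R]_3) :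
    circle R -> sphere3 R :=
  omap (fun t : R =>
    if t < 0 then head 0 vs + t *: point 0 1 0
    else if (size vs).-1%:R <= t
      then last 0 vs + (t - (size vs).-1%:R) *: point 0 1 0
    else let k := Num.truncn t in
      vs`_k + (t - k%:R) *: (vs`_k.+1 - vs`_k)).

Record knot (R : realType) := Knot {
  knot_map :> circle R -> sphere3 R;
  knot_continuous : continuous knot_map;
  knot_injective : injective knot_map;
  knot_tame : exists vs : seq 'rV[R]_3, knot_equiv (long_polygon vs) knot_map
}.

(* A diagram in the plane is put in Morse position and cut by horizontal lines
   into slices, listed from bottom to top. Each slice contains exactly one cup
   (local minimum), cap (local maximum) or crossing; the number paired with it
   counts the strands to its left. [Cross b]: the strand running from bottom
   left to top right is the over-strand iff b. *)
Inductive tile := Cup | Cap | Cross of bool.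
Definition slice := (tile * nat)%type.
Definition diagram := seq slice.

Definition mirror (s : slice) : slice :=
  (match s.1 with Cup => Cap | Cap => Cup | Cross b => Cross b end, s.2).

(* A strand entering the slice from below at position q leaves it at position
   q'; it leaves through the bottom of the slice iff [turned]. *)
Definition through (s : slice) (q : nat) : nat * bool :=
  let: (t, p) := s in
  match t with
  | Cup => (if (q < p)%N then q else q.+2, false)
  | Cap => if (q < p)%N then (q, false)
           else if q == p then (p.+1, true)
           else if q == p.+1 then (p, true)
           else ((q - 2)%N, false)
  | Cross _ => (if q == p then p.+1 else if q == p.+1 then p else q, false)
  end.

(* Level h is the horizontal line just below slice number h (from 0). A strand
   point (h, q, up): the knot is on level h, at position q (from 0), and
   travels upwards iff up. *)
Definition strand_point := (nat * nat * bool)%type.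

Definition slice_ahead (w : diagram) (x : strand_point) : option slice :=
  let: (h, _, up) := x in
  if up then onth w h else if h is h'.+1 then onth w h' else None.

Definition step (w : diagram) (x : strand_point) : strand_point :=
  let: (h, q, up) := x in
  let: (q', turned) :=
    if slice_ahead w x is Some s then through (if up then s else mirror s) q
    else (q, false) in
  (if turned then h else if up then h.+1 else h.-1, q', up (+) turned).

Definition fits (n : nat) (s : slice) : bool :=
  if s.1 is Cup then (s.2 <= n)%N else (s.2.+1 < n)%N.

Definition width_above (n : nat) (s : slice) : nat :=
  match s.1 with Cup => n.+2 | Cap => (n - 2)%N | Cross _ => n end.

Fixpoint stackable (n : nat) (w : diagram) : bool :=
  if w is s :: w' then fits n s && stackable (width_above n s) w' else n == 1%N.

Definition widths (w : diagram) : seq nat := 1%N :: scanl width_above 1%N w.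

Definition trace (w : diagram) : seq strand_point :=
  traject (step w) (0%N, 0%N, true) (sumn (widths w)).

(* [Some (h, over)] if from x the knot passes through the crossing in slice h,
   as the over-strand iff over. *)
Definition crossing_pass (w : diagram) (x : strand_point) :
    option (nat * bool) :=
  let: (h, q, up) := x in
  if slice_ahead w x is Some (Cross b, p) then
    if (q == p) || (q == p.+1)
    then Some (if up then h else h.-1, (q == p) == (b == up)) else None
  else None.

(* The trace has as many terms as there are strand points in the diagram, and
   beyond the top of the diagram [step] keeps going up. So the second condition
   says that the strand entering at the bottom visits every strand point before
   leaving at the top, that is, there is no further component. The third one
   says that both strands of every crossing are oriented upwards. *)
Definition upright (w : diagram) : bool :=
  [&& stackable 1 w,
      last (0%N, 0%N, true) (trace w) == (size w, 0%N, true)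
    & all (fun x => isSome (crossing_pass w x) ==> x.2) (trace w)].

(* Passages through crossings, in the order of the knot. Edges are numbered
   from 0: edge k ends at the k-th passage (also numbered from 0). *)
Definition passes (w : diagram) : seq (nat * bool) :=
  pmap (crossing_pass w) (trace w).

(* The triples (s, i, j): sign, incoming edge of the over-strand, incoming edge
   of the under-strand. *)
Definition crossing := (int * nat * nat)%type.

Definition crossings (w : diagram) : seq crossing :=
  pmap (fun h =>
    if onth w h is Some (Cross b, _) then
      Some ((if b then 1 else -1) : int,
            index (h, true) (passes w), index (h, false) (passes w))
    else None) (iota 0 (size w)).

(* Counterclockwise half-turns of the tangent made when leaving x. *)
Definition half_turn (w : diagram) (x : strand_point) : int :=
  let: (_, q, up) := x in
  let: (_, q', up') := step w x in
  if up' == up then 0 else if up == (q' < q)%N then 1 else -1.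

Definition rotation (w : diagram) (k : nat) : int :=
  ((\sum_(m < size (trace w) |
        count (isSome \o crossing_pass w) (take m (trace w)) == k)
      half_turn w (nth (0%N, 0%N, true) (trace w) m)) %/ 2)%Z.

(* The plane of the diagram is z = 0, seen from z > 0; position q on level h is
   the point (q, h, 0). At a crossing, the over-strand is lifted to z = 1 and
   the under-strand is lowered to z = -1. *)
Definition strand_vertices (R : realType) (w : diagram) (x : strand_point) :
    seq 'rV[R]_3 :=
  let: (h, q, up) := x in
  let: (_, q', _) := step w x in
  [:: point q%:R h%:R 0;
      point ((q + q')%:R / 2) (if up then h%:R + 1 / 2 else h%:R - 1 / 2)
        (match crossing_pass w x with
         | Some (_, true) => 1 | Some (_, false) => -1 | None => 0 end)].

Definition realization (R : realType) (w : diagram) : circle R -> sphere3 R :=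
  long_polygon (flatten [seq strand_vertices R w x | x <- trace w]).

Definition represents (R : realType) (w : diagram) (K : knot R) : Prop :=
  upright w /\ knot_equiv (realization w) K.

(* The connected sum is concatenation of long knots: the diagram w1 ++ w2 is w2
   placed on top of w1. *)
Definition is_connected_sum (R : realType) (K1 K2 K : knot R) : Prop :=
  exists w1 w2 : diagram,
    [/\ represents w1 K1, represents w2 K2 & represents (w1 ++ w2) K].

(* Fox matrix, abelianized, of the Wirtinger presentation with one generator
   per edge. The over-passage of (s, i, j) gives x_i = x_(i+1); the
   under-passage gives x_i x_(j+1) = x_j x_i if s = 1, and
   x_i x_j = x_(j+1) x_i if s = -1. Row r is the relation of passage r. *)
Definition alexander_matrix (cs : seq crossing) :
    'M[{poly int}]_((size cs).*2, (size cs).*2.+1) :=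
  \matrix_(r, e) \sum_(c <- cs) let: (s, i, j) := c in
    let x k : {poly int} := (e == k :> nat)%:R in
    (r == i :> nat)%:R * (x i - x i.+1)
    + (r == j :> nat)%:R *
      (if s == 1 then (1 - 'X) * x i + 'X * x j.+1 - x j
       else (1 - 'X) * x i + 'X * x j - x j.+1).

(* The pair (P, k) stands for the Laurent polynomial T^(-k) P(T). *)
Definition laurent := ({poly int} * nat)%type.

Definition laurent_eval (F : fieldType) (p : laurent) (t : F) : F :=
  (map_poly intr p.1).[t] / t ^+ p.2.

(* Delta(T) = Delta(T^-1). *)
Definition laurent_symmetric (p : laurent) : Prop :=
  (size p.1 <= p.2.*2.+1)%N /\
  forall i, (i <= p.2.*2)%N -> p.1`_i = p.1`_(p.2.*2 - i).

(* The Alexander polynomial is a maximal minor of the Alexander matrix, up to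
   units +-T^m; it is then normalized by symmetry and Delta(1) = 1. *)
Definition symmetric_alexander (w : diagram) (p : laurent) : Prop :=
  [/\ laurent_symmetric p, p.1.[1] = 1 &
      exists (a b : nat) (neg : bool),
        'X^a * p.1 =
        (-1) ^+ neg * 'X^b * \det (col' ord_max (alexander_matrix (crossings w)))].

(* Includes the classical fact that the polynomial exists and does not depend on
   the diagram; the conditions above determine it as a Laurent
   polynomial. *)
Definition is_alexander_invariant (R : realType) (Delta : knot R -> laurent) :=
  forall (K : knot R) (w : diagram),
    represents w K -> symmetric_alexander w (Delta K).

(* Q(T1, T2): T1 is the inner and T2 the outer variable. *)
Definition QT : fieldType := {fraction {poly {poly rat}}}.
Definition T1 : QT := FracField.tofrac (polyC 'X).
Definition T2 : QT := FracField.tofrac 'X.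
Definition T3 : QT := T1 * T2.

Definition norm_factor (p : laurent) : QT :=
  laurent_eval p T1 * laurent_eval p T2 * laurent_eval p T3.

(* [traffic_matrix cs t *m G = 1%:M] is the linear system defining the traffic
   function G, one row for each incoming edge i, j of a crossing and the last
   row for the last edge. *)
Definition traffic_matrix (cs : seq crossing) (t : QT) :
    'M[QT]_((size cs).*2.+1) :=
  \matrix_(a, b) ((a == b)%:R - \sum_(c <- cs) let: (s, i, j) := c in
    let x k : QT := (b == k :> nat)%:R in
    (a == i :> nat)%:R * (t ^ s * x i.+1 + (1 - t ^ s) * x j.+1)
    + (a == j :> nat)%:R * x j.+1).

Definition traffic (cs : seq crossing) (t : QT) (a b : nat) : QT :=
  invmx (traffic_matrix cs t) (inord a) (inord b).

Section StateSum.
Variables g1 g2 g3 : nat -> nat -> QT.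

Definition F1 (c : crossing) : QT :=
  let: (s, i, j) := c in
  s%:~R * (1 / 2 - g3 i i + T2 ^ s * g1 i i * g2 j i
           - T2 ^ s * g3 j j * g2 j i - (T2 ^ s - 1) * g3 i i * g2 j i
           + (T3 ^ s - 1) * g2 j i * g3 j i - g1 i i * g2 j j
           + 2 * g3 i i * g2 j j + g1 i i * g3 j j - g2 i i * g3 j j)
  + s%:~R / (T2 ^ s - 1) *
    ((T1 ^ s - 1) * T2 ^ s *
       (g3 j j * g1 j i - g2 j j * g1 j i + T2 ^ s * g1 j i * g2 j i)
     + (T3 ^ s - 1) *
       (g3 j i - T2 ^ s * g1 i i * g3 j i + g2 i j * g3 j i
        + (T2 ^ s - 2) * g2 j j * g3 j i)
     - (T1 ^ s - 1) * (T2 ^ s + 1) * (T3 ^ s - 1) * g1 j i * g3 j i).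

Definition F2 (c0 c1 : crossing) : QT :=
  let: (s0, i0, j0) := c0 in
  let: (s1, i1, j1) := c1 in
  s1%:~R * (T1 ^ s0 - 1) * (T3 ^ s1 - 1) * g1 j1 i0 * g3 j0 i1 / (T2 ^ s1 - 1)
  * (T2 ^ s0 * g2 i1 i0 + g2 j1 j0 - T2 ^ s0 * g2 j1 i0 - g2 i1 j0).

Definition F3 (phi : int) (k : nat) : QT := phi%:~R * (g3 k k - 1 / 2).

End StateSum.

Definition state_sum (w : diagram) : QT :=
  let cs := crossings w in
  let g1 := traffic cs T1 in
  let g2 := traffic cs T2 in
  let g3 := traffic cs T3 in
  \sum_(c <- cs) F1 g1 g2 g3 c
  + \sum_(c0 <- cs) \sum_(c1 <- cs) F2 g1 g2 g3 c0 c1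
  + \sum_(k < (size cs).*2.+1) F3 g3 (rotation w k) k.

(* Includes the theorem that the value does not depend on the diagram. Every
   tame knot has an upright diagram, so theta is determined. *)
Definition is_theta_invariant (R : realType)
    (Delta : knot R -> laurent) (theta : knot R -> QT) :=
  forall (K : knot R) (w : diagram),
    represents w K -> theta K = norm_factor (Delta K) * state_sum w.

(* Main.v *)
Require Import Defs.
From mathcomp Require Import all_boot all_order all_algebra.
From mathcomp Require Import all_classical all_reals all_analysis.
From mathcomp Require Import zify ring.

Import GRing.Theory.
Local Open Scope ring_scope.

(** The connected sum is realized by stacking the long knot of [w2] on that of
    [w1], and the formula follows once two things are known about the stacked
    diagram [w1 ++ w2]: its Alexander polynomial is the product of those of the
    two parts, and its state sum is the sum of theirs. Then
    [N(K) * S = N(K1) * N(K2) * (S1 + S2)], which is the claim.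

    Both facts rest on the labelling of the edges. The knot runs through all
    of [w1] and only then enters [w2], and inside [w1] it passes each of the
    [n1] crossings exactly twice. Hence the crossings of [w1] keep their
    labels, which are smaller than [2 * n1], and those of [w2] have theirs
    raised by exactly [2 * n1] ([crossings_cat]). The last edge of [w1] and the
    first edge of [w2] merge into the edge [2 * n1]; its rotation number is the
    sum of theirs ([rotation_cat]). That each crossing is passed twice is the
    one geometric point: the motion along the knot is reversible, so a long
    knot that finally leaves at the top never comes back to a position, in
    either direction, and a trace as long as the number of positions visits
    them all ([trace_meets_every_position]).

    The crossings of [w2] lead only to edges of [w2], so a car in [w2] never
    gets back to [w1]. Hence the traffic matrix is block triangular, and the
    traffic function of the stacked diagram restricts to those of the two parts
    and vanishes from [w2] to [w1] ([traffic_cat_l], [traffic_cat_r],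
    [traffic_cat_rl]). Each term of F2 for a pair of crossings in different
    parts has a factor of traffic from a crossing of [w2] to one of [w1], so
    these terms vanish, and F1 and F3 split without interaction; on the merged
    edge the traffic from the edge to itself is 1 in all three diagrams
    ([state_sum_cat]). The linear systems are nonsingular because at [T = 1]
    all cars stay on their strand, and the matrix becomes unitriangular
    ([traffic_matrix_unit]).

    The maximal minors of the Alexander matrices are block triangular in the
    same way, so they multiply ([alexander_minor_cat]). A unit [+-T^m] is left
    undetermined; the symmetry under [T -> 1/T] and the value 1 at [T = 1] fix
    it ([symmetric_unique]), so the normalized polynomials multiply as well
    ([norm_factor_cat]). *)

Set Implicit Arguments.
Unset Strict Implicit.
Import Num.Theory.

(** * Reversing the passage through a slice *)

Definition opposite (x : strand_point) : strand_point :=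
  let: (h, q, up) := x in (h, q, ~~ up).

(** Read backwards, a slice is a slice again: [mirror s] exchanges its bottom and
    its top. So a strand that leaves at [q'] and turns round retraces its way,
    through [mirror s] after going up and through [s] after going down. *)
Lemma through_reversible (n : nat) (s : slice) (up : bool) (q : nat) :
  fits n s -> (q < if up then n else width_above n s)%N ->
  let: (q1, turned) := through (if up then s else mirror s) q in
  let up' := up (+) turned in
  [/\ (q1 < if up' then width_above n s else n)%N,
      through (if up' then mirror s else s) q1 = (q, turned)
    & turned -> q1 != q].
Proof.
case: s => [[||b] p]; case: up; rewrite /fits /width_above /= => fit lt_q;
repeat (case: ifP => /=); move=> *; split=> //; try lia;
repeat (case: ifP => /=); move=> *; try (congr (_, _)); lia.
Qed.

(** Turning round just after a step, one faces the slice just crossed. *)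
Lemma slice_ahead_opposite (w : diagram) (x : strand_point) (s : slice) :
  slice_ahead w x = Some s -> slice_ahead w (opposite (step w x)) = Some s.
Proof.
case: x => [[h q] up] ahead; rewrite /step ahead.
case: (through _ _) => q1 turned.
by case: up ahead; case: turned; case: h.
Qed.

Definition width (w : diagram) (h : nat) : nat :=
  foldl width_above 1%N (take h w).

Lemma width_top (w : diagram) : stackable 1 w -> width w (size w) = 1%N.
Proof.
rewrite /width take_size.
suff top n : stackable n w -> foldl width_above n w = 1%N by exact: top.
by elim: w n => [|s w IHw] n /= => [/eqP | /andP[_ /IHw]].
Qed.

Lemma width_fits (w : diagram) (h : nat) (s : slice) :
  stackable 1 w -> onth w h = Some s ->
  fits (width w h) s /\ width w h.+1 = width_above (width w h) s.
Proof.
rewrite /width; elim: w h 1%N => [|s' w IHw] [|h] n //= /andP[fit stk].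
  by case=> <-; rewrite take0.
exact: IHw.
Qed.

Definition on_diagram (w : diagram) (x : strand_point) : bool :=
  let: (h, q, _) := x in (h <= size w)%N && (q < width w h)%N.

Lemma onth_lt (T : Type) (l : seq T) (h : nat) (s : T) :
  onth l h = Some s -> (h < size l)%N.
Proof. by rewrite -onthTE => ->. Qed.

(** The last conclusion says that a step never turns the knot back onto
    the position it came from: it changes the level, or it is a turn, and then
    it changes the position within the level. *)
Lemma step_reversible (w : diagram) (x : strand_point) :
  stackable 1 w -> on_diagram w x -> isSome (slice_ahead w x) ->
  [/\ on_diagram w (step w x), step w (opposite (step w x)) = opposite x
    & step w x != opposite x].
Proof.
move=> stk; case ahead: (slice_ahead w x) => [s|] // on_x _.
have back := slice_ahead_opposite ahead.
case: x => [[h q] up] in ahead on_x back *.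
(* Slice [k] lies between the levels [k] and [k.+1]. *)
have [n [k [slice_k onx]]] : exists n k, onth w k = Some s
   /\ n = width w k /\ h = (~~ up + k)%N /\ (q < if up then n else width_above n s)%N.
  case: up ahead on_x {back} => /=; last case: h => // k.
    move=> ah /andP[_ lt_q]; by exists (width w h), h.
  move=> ah /andP[_ lt_q]; exists (width w k), k; do !split=> //.
  by have [_ <-] := width_fits stk ah.
case: onx => -> {n} [h_k lt_q].
have [fit wide] := width_fits stk slice_k.
have lt_k := onth_lt slice_k.
have := through_reversible fit lt_q.
case E: through => [q1 turned]; case=> lt_q1 back_thr neq.
have stepE : step w (h, q, up)
    = (if turned then h else if up then h.+1 else h.-1, q1, up (+) turned).
  by rewrite /step ahead E.
rewrite stepE in back *; rewrite h_k in back *.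
split.
- by move: lt_q1; case: (up) (turned) => [] [] /=; rewrite ?add0n ?add1n ?wide => ltq;
  rewrite ltq; lia.
- by rewrite /step back; move: back_thr; case: (up) (turned) => [] [] /= ->.
- move: neq; case: (up) (turned) => [] [] //= neq; rewrite ?xpair_eqE /= ?andbF //;
  by rewrite (negPf (neq isT)) andbF.
Qed.

(** * The long knot visits every position once *)

Definition start : strand_point := (0%N, 0%N, true).

Local Notation visit w k := (iter k (step w) start).

(** A point with no slice ahead of it is at the bottom facing down, where [step]
    stays for ever, or at the top facing up, from where it climbs for ever.
    Neither way leads to the top level at a later time. *)
Lemma exit_final (w : diagram) (x : strand_point) (k : nat) :
  on_diagram w x -> ~~ isSome (slice_ahead w x) ->
  iter k.+1 (step w) x != (size w, 0%N, true).
Proof.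
case: x => [[h q] []] /= /andP[le_h _].
  rewrite onthNE => ge_h.
  suff -> : iter k (step w) (h, q, true) = (h + k, q, true)%N.
    rewrite /step /=; case ahead: (onth w (h + k)%N) => [s|].
      by have := onth_lt ahead; lia.
    by rewrite !xpair_eqE; lia.
  elim: k => [|k IHk]; first by rewrite addn0.
  rewrite iterS IHk /step /=; case ahead: (onth w (h + k)%N) => [s|].
    by have := onth_lt ahead; lia.
  by rewrite addnS.
case: h le_h => [|h] lt_h; last by rewrite onthTE lt_h.
suff -> : iter k (step w) (0%N, q, false) = (0%N, q, false) by rewrite xpair_eqE andbF.
by elim: k => //= k ->.
Qed.

Section Upright.
Variables (w : diagram) (up_w : upright w).

Let stk : stackable 1 w. Proof. by case/and3P: up_w. Qed.

Lemma trace_size_gt0 : (0 < sumn (widths w))%N.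
Proof. by []. Qed.

Lemma traceE :
  trace w = [seq visit w k | k <- iota 0 (sumn (widths w))].
Proof.
rewrite /trace; apply: (@eq_from_nth _ start); first by rewrite size_map size_iota size_traject.
move=> k; rewrite size_traject => lt_k.
by rewrite nth_traject // (nth_map 0%N) ?size_iota // nth_iota.
Qed.

Lemma last_visit : visit w (sumn (widths w)).-1 = (size w, 0%N, true).
Proof.
case/and3P: up_w => _ /eqP + _; rewrite /trace.
by case: (sumn _) trace_size_gt0 => //= n _; rewrite last_traject.
Qed.

Lemma visit_stays (k : nat) : on_diagram w (visit w k) ->
  (k.+1 < sumn (widths w))%N -> isSome (slice_ahead w (visit w k)).
Proof.
move=> on_k lt_k1; apply/negPn/negP => out.
have := exit_final (sumn (widths w) - k.+2)%N on_k out.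
rewrite -iterD -last_visit; set a := (_ + _)%N; set b := _.-1.
have -> : a = b by rewrite /a /b; lia.
by rewrite eqxx.
Qed.

Lemma visit_on_diagram (k : nat) :
  (k < sumn (widths w))%N -> on_diagram w (visit w k).
Proof.
elim: k => [|k IHk] lt_k; first by rewrite /= /width take0.
have on_k := IHk (ltnW lt_k).
by have [] := step_reversible stk on_k (visit_stays on_k lt_k).
Qed.

Lemma visit_reversible (k : nat) : (k.+1 < sumn (widths w))%N ->
  step w (opposite (visit w k.+1)) = opposite (visit w k)
  /\ visit w k.+1 != opposite (visit w k).
Proof.
move=> lt_k; have on_k := visit_on_diagram (ltnW lt_k).
by have [] := step_reversible stk on_k (visit_stays on_k lt_k).
Qed.

(** Otherwise the knot would run between times [a] and [b] along a path that
    equals its own reversal. By reversibility one can shorten the path from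
    both ends at once, until in the middle either a point equals its opposite or
    a step is a mere reversal, and neither is possible. *)
Lemma never_retraced (a b : nat) : (a <= b < sumn (widths w))%N ->
  visit w b != opposite (visit w a).
Proof.
case/andP=> /subnKC <-; move: (b - a)%N => {b} n.
elim/ltn_ind: n a => -[|[|d]] IHd a lt_b.
- rewrite addn0; case: (visit w a) => [[h q] []]; by rewrite /= xpair_eqE andbF.
- by rewrite addn1 in lt_b *; have [] := visit_reversible lt_b.
have lt_a : (a.+1 < sumn (widths w))%N by lia.
apply: contraNneq (IHd d (ltnW (ltnSn _)) a.+1 _) => [back|]; last by lia.
have oppK : involutive opposite by case=> [[h q] []].
have [stepa _] := visit_reversible lt_a.
have lt_d : ((a + d.+1).+1 < sumn (widths w))%N by lia.
have [stepb _] := visit_reversible lt_d.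
by rewrite addSnnS -[visit w _]oppK -stepb -addnS back oppK.
Qed.

(** A repetition makes the motion periodic, so the exit at the top, which is
    reached at the end, would also be reached earlier; but then the
    knot would already have left the diagram. *)
Lemma never_revisited (a b : nat) : (a < b < sumn (widths w))%N ->
  visit w a != visit w b.
Proof.
case/andP=> lt_ab lt_b; apply/eqP => same.
(* The time at which the knot is already where it is at the end. *)
have lt_k : ((a + (sumn (widths w)).-1 - b).+1 < sumn (widths w))%N by lia.
have on_k := visit_on_diagram (ltnW lt_k).
have := visit_stays on_k lt_k.
have -> : (a + (sumn (widths w)).-1 - b = ((sumn (widths w)).-1 - b) + a)%N by lia.
rewrite iterD same -iterD.
have -> : ((sumn (widths w)).-1 - b + b = (sumn (widths w)).-1)%N by lia.
by rewrite last_visit /= onthTE ltnn.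
Qed.

(** The trace passes through each position at most once, whatever its
    direction, and its length is the number of positions. *)
Lemma trace_meets_every_position (h q : nat) :
  (h <= size w)%N -> (q < width w h)%N -> exists up, (h, q, up) \in trace w.
Proof.
pose pos (x : strand_point) := (x.1.1, x.1.2).
pose all_pos := [seq (h, q) | h <- iota 0 (size w).+1, q <- iota 0 (width w h)].
have size_all : size all_pos = sumn (widths w).
  rewrite size_allpairs_dep; congr sumn.
  apply: (@eq_from_nth _ 0%N); first by rewrite size_map size_iota /= size_scanl.
  move=> i; rewrite size_map size_iota ltnS => le_i.
  rewrite (nth_map 0%N) ?size_iota // nth_iota // add0n /width.
  by case: i le_i => [|i] lt_i; rewrite ?take0 //= nth_scanl.
have uniq_pos : uniq (map pos (trace w)).
  rewrite traceE -map_comp map_inj_in_uniq ?iota_uniq // => a b.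
  rewrite !mem_iota /= !add0n => lt_a lt_b same.
  wlog lt_ab : a b lt_a lt_b same / (a < b)%N.
    by case: (ltngtP a b) => // lt wl; [|symmetry]; apply: wl.
  have := @never_revisited a b; have := @never_retraced a b.
  rewrite lt_ab ltnW // lt_b => /(_ isT) + /(_ isT).
  case: (visit w a) (visit w b) same => [[ha qa] ua] [[hb qb] ub] [-> ->].
  by rewrite /= !xpair_eqE !eqxx /=; case: (ua) (ub) => [] [].
have sub_pos : {subset map pos (trace w) <= all_pos}.
  rewrite traceE -map_comp => _ /mapP[k + ->].
  rewrite mem_iota add0n => lt_k; have := visit_on_diagram lt_k.
  rewrite /=; case: (visit w k) => [[h' q'] u] /andP[le_h lt_q].
  by apply/allpairsPdep; exists h', q'; rewrite !mem_iota; split=> //; lia.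
have [|_ eq_pos] := uniq_min_size uniq_pos sub_pos.
  by rewrite size_all size_map size_traject.
move=> le_h lt_q.
have : (h, q) \in map pos (trace w).
  rewrite eq_pos.
  by apply/allpairsPdep; exists h, q; rewrite !mem_iota; split=> //; lia.
by case/mapP=> -[[h' q'] up] in_tr [-> ->]; exists up.
Qed.

Lemma trace_uniq : uniq (trace w).
Proof.
rewrite traceE map_inj_in_uniq ?iota_uniq // => a b.
rewrite !mem_iota /= !add0n => lt_a lt_b same.
by case: (ltngtP a b) => // lt; have := @never_revisited _ _;
  [move/(_ a b) | move/(_ b a)]; rewrite lt ?lt_a ?lt_b same eqxx => /(_ isT).
Qed.

End Upright.

(** * Every crossing is passed once over and once under *)

Definition crosses (w : diagram) (h : nat) : bool :=
  if onth w h is Some (Cross _, _) then true else false.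

(** The strand point from which an upward knot makes the pass [c]. The strand
    from bottom left to top right starts at [p], and it is the over-strand iff
    [b]. *)
Definition pass_point (w : diagram) (c : nat * bool) : strand_point :=
  if onth w c.1 is Some (Cross b, p)
  then (c.1, if c.2 == b then p else p.+1, true) else start.

Lemma crossing_pass_crosses (w : diagram) (x : strand_point) (c : nat * bool) :
  crossing_pass w x = Some c -> crosses w c.1.
Proof.
case: x => [[h q] []]; rewrite /crossing_pass /crosses /=.
  by case ahead: (onth w h) => [[[||b] p]|] //; case: ifP => // _ [<-]; rewrite ahead.
case: h => // h.
by case ahead: (onth w h) => [[[||b] p]|] //; case: ifP => // _ [<-]; rewrite ahead.
Qed.

Lemma crossing_passK (w : diagram) (x : strand_point) (c : nat * bool) :
  x.2 -> crossing_pass w x = Some c -> pass_point w c = x.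
Proof.
case: x => [[h q] []] // _; rewrite /crossing_pass /pass_point /=.
case ahead: (onth w h) => [[[||b] p]|] //; case: ifP => // at_p [<-] /=.
rewrite ahead; case: (eqVneq q p) at_p => [->|_ /eqP->]; by case: b {ahead}.
Qed.

Lemma pass_pointK (w : diagram) (c : nat * bool) :
  crosses w c.1 -> crossing_pass w (pass_point w c) = Some c.
Proof.
case: c => h o; rewrite /crosses /pass_point /crossing_pass /=.
case ahead: (onth w h) => [[[||b] p]|] //= _.
by rewrite ahead; case: o b {ahead} => [] [] /=; rewrite ?eqxx ?orbT ?(gtn_eqF (ltnSn p)).
Qed.

Section Upright.
Variables (w : diagram) (up_w : upright w).

Lemma passes_upwards (x : strand_point) :
  x \in trace w -> isSome (crossing_pass w x) -> x.2.
Proof. by case/and3P: up_w => _ _ /allP all_up /all_up /implyP. Qed.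

(** The position below the crossing is visited. If it were visited downwards, then
    the knot would just before have gone through the crossing downwards, which
    an upright diagram excludes. *)
Lemma pass_point_in_trace (c : nat * bool) :
  crosses w c.1 -> pass_point w c \in trace w.
Proof.
case: c => h o /= cross_h; have stk : stackable 1 w by case/and3P: up_w.
have := pass_pointK (c := (h, o)) cross_h.
move: cross_h; rewrite /crosses /pass_point /=.
case ahead: (onth w h) => [[[||b] p]|] //= _ _.
have [fit _] := width_fits stk ahead; set q := if _ then _ else _.
have lt_q : (q < width w h)%N by rewrite /q; case: ifP fit => _; rewrite /fits /=; lia.
have lt_h := onth_lt ahead.
have [[] // ] := trace_meets_every_position up_w (ltnW lt_h) lt_q.
rewrite traceE => /mapP[[|k]] //; rewrite mem_iota add0n => /andP[_ lt_k] down.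
have [back _] := visit_reversible up_w lt_k.
have in_k : visit w k \in trace w.
  by rewrite traceE; apply/mapP; exists k; rewrite // mem_iota; lia.
have := passes_upwards in_k.
move: back; rewrite (esym down : visit w k.+1 = _) /step /= ahead /=.
case: (visit w k) => [[h' q'] []] /=.
  by case: (_ == _) => //; case: (_ == _).
by rewrite /q; case: (o == b); rewrite ?eqxx ?(gtn_eqF (ltnSn p)) => -[<- <-] /=;
  rewrite ahead !eqxx ?orbT => /(_ isT).
Qed.

Lemma mem_passes (c : nat * bool) : (c \in passes w) = crosses w c.1.
Proof.
rewrite mem_pmap; apply/mapP/idP => [[x _ /esym] | cross_c].
  exact: crossing_pass_crosses.
by exists (pass_point w c); rewrite ?pass_pointK ?pass_point_in_trace.
Qed.

Lemma passes_uniq : uniq (passes w).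
Proof.
apply: (@map_uniq _ _ (pass_point w)).
suff -> : map (pass_point w) (passes w)
    = [seq x <- trace w | isSome (crossing_pass w x)].
  by rewrite filter_uniq // trace_uniq.
rewrite /passes; have := @passes_upwards.
elim: (trace w) => //= x l IHl all_up.
have {}IHl := IHl (fun y in_l => all_up y (mem_behead (in_l : y \in behead (x :: l)))).
case pass_x: (crossing_pass w x) => [c|] //=.
by rewrite IHl (@crossing_passK w x) // all_up ?mem_head ?pass_x.
Qed.

Lemma size_passes : size (passes w) = (size (crossings w)).*2.
Proof.
pose heights := [seq h <- iota 0 (size w) | crosses w h].
have -> : size (crossings w) = size heights.
  rewrite size_pmap size_filter; apply: eq_count => h.
  by rewrite /crosses; case: (onth w h) => [[[]]|].
have /perm_size -> : perm_eq (passes w) [seq (h, o) | h <- heights, o <- [:: true; false]].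
  apply: uniq_perm; first exact: passes_uniq.
    by apply: allpairs_uniq => [| |[? ?] [? ?]]; rewrite ?filter_uniq ?iota_uniq.
  case=> h o; rewrite mem_passes /=; apply/idP/flatten_mapP => [cross_h | [k]] /=.
    exists h; last by case: o; rewrite !inE eqxx ?orbT.
    rewrite mem_filter mem_iota cross_h.
    by move: cross_h; rewrite /crosses; case: (onth w h) (@onth_lt _ w h) => [s|] //= /(_ s erefl).
  by rewrite mem_filter !inE => /andP[cross_k _] /orP[] /eqP[->].
by rewrite size_allpairs muln2.
Qed.

Lemma crossing_labels_lt (s : int) (i j : nat) : (s, i, j) \in crossings w ->
  (i < (size (crossings w)).*2)%N /\ (j < (size (crossings w)).*2)%N.
Proof.
rewrite mem_pmap => /mapP[h _].
have := mem_passes (h, _); rewrite /crosses /=.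
case: (onth w h) => [[[||b] p]|] // passed [_ -> ->].
by rewrite -size_passes !index_mem !passed.
Qed.
End Upright.

(** * Stacking one long knot on another *)

Definition raise (n : nat) (x : strand_point) : strand_point :=
  let: (h, q, up) := x in ((h + n)%N, q, up).

(** Excludes the points on the bottom level that face down. When a diagram is
    placed on top of another one, these are the points whose next slice
    changes. *)
Definition above_floor (x : strand_point) : bool := x.2 || (0 < x.1.1)%N.

Lemma slice_ahead_above_floor (w : diagram) (x : strand_point) :
  isSome (slice_ahead w x) -> above_floor x.
Proof. by case: x => [[[|h] q] []]. Qed.

Lemma slice_ahead_catl (w1 w2 : diagram) (x : strand_point) :
  isSome (slice_ahead w1 x) -> slice_ahead (w1 ++ w2) x = slice_ahead w1 x.
Proof.
by case: x => [[[|h] q] []] // ahead; rewrite /slice_ahead onth_cat -onthTE ahead.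
Qed.

Lemma slice_ahead_catr (w1 w2 : diagram) (x : strand_point) :
  above_floor x -> slice_ahead (w1 ++ w2) (raise (size w1) x) = slice_ahead w2 x.
Proof.
case: x => [[h q] []]; last case: h => // h; move=> _;
  by rewrite /raise ?addSn /slice_ahead onth_cat ltnNge leq_addl addnK.
Qed.

Lemma step_catl (w1 w2 : diagram) (x : strand_point) :
  isSome (slice_ahead w1 x) -> step (w1 ++ w2) x = step w1 x.
Proof. by move/(slice_ahead_catl w2); rewrite /step; case: x => [[h q] up] ->. Qed.

Lemma step_catr (w1 w2 : diagram) (x : strand_point) :
  above_floor x -> step (w1 ++ w2) (raise (size w1) x) = raise (size w1) (step w2 x).
Proof.
move=> above; move/(slice_ahead_catr w1 w2): (above); rewrite /step.
case: x above => [[h q] up] above; rewrite {1 2}/raise => ->.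
case: (if slice_ahead w2 _ is Some _ then _ else _) => q' turned.
by case: up turned h above => [] [] [|h] //= _; rewrite ?addSn.
Qed.

Lemma crossing_pass_catl (w1 w2 : diagram) (x : strand_point) :
  isSome (slice_ahead w1 x) -> crossing_pass (w1 ++ w2) x = crossing_pass w1 x.
Proof.
by move/(slice_ahead_catl w2); rewrite /crossing_pass; case: x => [[h q] up] ->.
Qed.

Definition raise_pass (n : nat) (c : nat * bool) : nat * bool := ((c.1 + n)%N, c.2).

Lemma crossing_pass_catr (w1 w2 : diagram) (x : strand_point) :
  above_floor x -> crossing_pass (w1 ++ w2) (raise (size w1) x)
    = omap (raise_pass (size w1)) (crossing_pass w2 x).
Proof.
move=> above; move/(slice_ahead_catr w1 w2): (above); rewrite /crossing_pass.
case: x above => [[h q] up] above; rewrite {1}/raise => ->.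
case: (slice_ahead w2 _) => [[[||b] p]|] //; rewrite /=; case: (_ || _) => //=.
by case: up h above => [] [|h] //= _; rewrite ?addSn.
Qed.

Lemma half_turn_catl (w1 w2 : diagram) (x : strand_point) :
  isSome (slice_ahead w1 x) -> half_turn (w1 ++ w2) x = half_turn w1 x.
Proof. by move=> ahead; rewrite /half_turn step_catl. Qed.

Lemma half_turn_catr (w1 w2 : diagram) (x : strand_point) :
  above_floor x -> half_turn (w1 ++ w2) (raise (size w1) x) = half_turn w2 x.
Proof.
move=> above; rewrite /half_turn step_catr //.
by case: (step w2 x) => [[h1 q1] up1]; case: x above => [[h q] up].
Qed.

(** The trace without its last point, which is the exit at the top. In a
    stacked diagram that point is the starting point of the upper part, and is
    counted there. *)
Definition ascent (w : diagram) : seq strand_point :=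
  [seq visit w k | k <- iota 0 (sumn (widths w)).-1].

Section Upright.
Variables (w : diagram) (up_w : upright w).

Lemma trace_rcons : trace w = rcons (ascent w) (size w, 0%N, true).
Proof.
rewrite traceE -(last_visit up_w) /ascent -map_rcons; congr map.
case: (sumn _) (trace_size_gt0 w) => // n _.
by rewrite -[RHS]/(rcons (iota 0 n) n) -cats1 -[n.+1]addn1 iotaD.
Qed.

Lemma ascent_ahead (x : strand_point) :
  x \in ascent w -> isSome (slice_ahead w x).
Proof.
case/mapP=> k; rewrite mem_iota => /andP[_ lt_k] ->.
have lt_k1 : (k.+1 < sumn (widths w))%N by lia.
by apply: visit_stays => //; apply: visit_on_diagram => //; apply: ltnW.
Qed.

Lemma trace_above_floor (x : strand_point) : x \in trace w -> above_floor x.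
Proof.
rewrite trace_rcons mem_rcons inE => /predU1P[-> // | /ascent_ahead].
exact: slice_ahead_above_floor.
Qed.

End Upright.

Section Stacking.
Variables (w1 w2 : diagram) (up1 : upright w1) (up2 : upright w2).

(** The part of the trace inside [w1] never looks beyond the top of [w1], and the
    part inside [w2] never faces down on the bottom level of [w2]; on either
    part the motion is that of the separate diagram. The lengths fit since the
    two parts share one level, of width 1. *)
Lemma trace_cat : trace (w1 ++ w2) = ascent w1 ++ map (raise (size w1)) (trace w2).
Proof.
have stk1 : stackable 1 w1 by case/and3P: up1.
pose N1 := sumn (widths w1); pose N2 := sumn (widths w2).
have sumE : sumn (widths (w1 ++ w2)) = (N1.-1 + N2)%N.
  rewrite /N1 /N2 /widths scanl_cat /= sumn_cat.
  by have := width_top stk1; rewrite /width take_size => ->; lia.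
have bottom k : (k < N1)%N -> visit (w1 ++ w2) k = visit w1 k.
  elim: k => // k IHk lt_k; rewrite !iterS IHk ?step_catl //; last exact: ltnW.
  by apply: ascent_ahead => //; apply: map_f; rewrite mem_iota; lia.
have top k : (k < N2)%N ->
    visit (w1 ++ w2) (N1.-1 + k) = raise (size w1) (visit w2 k).
  elim: k => [_|k IHk lt_k]; first by rewrite addn0 bottom ?last_visit // ltn_predL.
  rewrite addnS !iterS IHk ?step_catr //; last exact: ltnW.
  apply: (trace_above_floor up2); rewrite traceE; apply: (map_f (fun k => visit w2 k)).
  by rewrite mem_iota; lia.
rewrite traceE sumE iotaD map_cat; congr cat.
  by apply/eq_in_map => k; rewrite mem_iota => lt_k; apply: bottom; lia.
rewrite traceE -map_comp add0n -[X in iota X]addn0 iotaDl -map_comp.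
by apply/eq_in_map => k; rewrite mem_iota => lt_k; apply: top; lia.
Qed.

Lemma passes_cat :
  passes (w1 ++ w2) = passes w1 ++ map (raise_pass (size w1)) (passes w2).
Proof.
have top_pass : pmap (crossing_pass w1) [:: (size w1, 0%N, true)] = [::].
  by rewrite /= onth_default.
rewrite /passes trace_cat (trace_rcons up1) -cats1 !pmap_cat top_pass cats0.
congr cat; first by apply: eq_in_pmap => x /(ascent_ahead up1); apply: crossing_pass_catl.
have := trace_above_floor up2; elim: (trace w2) => //= x l IHl above.
rewrite crossing_pass_catr ?above ?mem_head // IHl => [|y in_l].
  by case: (crossing_pass w2 x).
by rewrite above // inE in_l orbT.
Qed.

Definition shift_labels (n : nat) (c : crossing) : crossing :=
  let: (s, i, j) := c in (s, (n + i)%N, (n + j)%N).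

Lemma crossings_cat : crossings (w1 ++ w2)
  = crossings w1 ++ map (shift_labels (size (crossings w1)).*2) (crossings w2).
Proof.
have in_passes c : crosses w1 c.1 -> index c (passes (w1 ++ w2)) = index c (passes w1).
  by move=> cross_c; rewrite passes_cat index_cat mem_passes // cross_c.
have over_passes c : index (raise_pass (size w1) c) (passes (w1 ++ w2))
    = ((size (crossings w1)).*2 + index c (passes w2))%N.
  rewrite passes_cat index_cat mem_passes // /crosses /= onth_default ?leq_addl //.
  by rewrite size_passes // index_map // => -[h o] [h' o'] [] /addIn <- <-.
rewrite {1}/crossings size_cat iotaD pmap_cat; congr cat.
  apply: eq_in_pmap => h; rewrite mem_iota add0n => /andP[_ lt_h].
  rewrite onth_cat lt_h; case ahead: (onth w1 h) => [[[||b] p]|] //.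
  have cross_h : crosses w1 h by rewrite /crosses ahead.
  by rewrite !in_passes.
rewrite add0n -[X in iota X]addn0 iotaDl [crossings w2]/crossings.
elim: (iota 0 (size w2)) => //= h l IHl.
rewrite onth_cat ltnNge leq_addr /= addKn.
case: (onth w2 h) => [[[||b] p]|] //=; congr (_ :: _); last by [].
by have := over_passes (h, _); rewrite /raise_pass /= addnC => H; rewrite !H.
Qed.

End Stacking.

(** * Rotation numbers of a stacked diagram *)

(** The half-turns of edge [k] along an arbitrary list of points; [rotation] is
    half of this number for the trace. Unlike the halves, these numbers are
    additive without any parity condition. *)
Definition edge_turns (w : diagram) (l : seq strand_point) (k : nat) : int :=
  \sum_(m < size l | count (isSome \o crossing_pass w) (take m l) == k)
    half_turn w (nth start l m).

Lemma edge_turns_cat (w : diagram) (l1 l2 : seq strand_point) (k : nat) :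
  let c1 := count (isSome \o crossing_pass w) l1 in
  edge_turns w (l1 ++ l2) k
  = edge_turns w l1 k + (if (c1 <= k)%N then edge_turns w l2 (k - c1) else 0).
Proof.
move=> c1; rewrite /edge_turns -!(big_mkord (fun m => count _ (take m _) == k)
  (fun m => half_turn w (nth start _ m))) size_cat.
rewrite (big_cat_nat (n := size l1)) ?leq_addr //=; congr (_ + _).
  rewrite big_nat_cond [RHS]big_nat_cond; apply: eq_big => [m|m /andP[/andP[_ lt_m] _]].
    by case lt_m: (m < size l1)%N; rewrite ?andbF // takel_cat // ltnW.
  by rewrite nth_cat lt_m.
rewrite -{1}[size l1]add0n big_addn addKn big_mkord.
case: ifP => [le_c|/negbT gt_c].
  apply: eq_big => m; last by rewrite nth_cat ltnNge leq_addl /= addnK.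
  by rewrite addnC takeD take_size_cat // drop_size_cat // count_cat -/c1; lia.
rewrite big1 // => m; rewrite addnC takeD take_size_cat // count_cat -/c1; lia.
Qed.

Lemma edge_turns_map (w w' : diagram) (f : strand_point -> strand_point)
    (l : seq strand_point) (k : nat) :
  (forall x, x \in l -> isSome (crossing_pass w (f x)) = isSome (crossing_pass w' x)) ->
  (forall x, x \in l -> half_turn w (f x) = half_turn w' x) ->
  edge_turns w (map f l) k = edge_turns w' l k.
Proof.
move=> same_pass same_turn; rewrite /edge_turns size_map.
apply: eq_big => [m|m _]; last first.
  by rewrite (nth_map start) // same_turn // mem_nth.
rewrite -map_take count_map; congr (_ == _); apply: eq_in_count => x in_l.
by rewrite /= same_pass // (mem_take in_l).
Qed.

Lemma edge_turns_out (w : diagram) (l : seq strand_point) (k : nat) :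
  (count (isSome \o crossing_pass w) l < k)%N -> edge_turns w l k = 0.
Proof.
move=> lt_k; rewrite /edge_turns big1 // => m /eqP count_m.
have : (count (isSome \o crossing_pass w) (take m l) <= count (isSome \o crossing_pass w) l)%N.
  by rewrite -[X in (_ <= count _ X)%N](cat_take_drop m l) count_cat leq_addr.
by rewrite count_m leqNgt lt_k.
Qed.

Lemma count_passes (w : diagram) :
  count (isSome \o crossing_pass w) (trace w) = size (passes w).
Proof. by rewrite size_pmap; apply: eq_count => x; rewrite /=; case: crossing_pass. Qed.

Section Upright.
Variables (w : diagram) (up_w : upright w).

Lemma count_ascent : count (isSome \o crossing_pass w) (ascent w) = size (passes w).
Proof.
by rewrite -count_passes (trace_rcons up_w) -cats1 count_cat /= onth_default //= !addn0.
Qed.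

Lemma edge_turns_ascent (k : nat) :
  edge_turns w (trace w) k = edge_turns w (ascent w) k.
Proof.
rewrite (trace_rcons up_w) -cats1 edge_turns_cat; case: ifP => _; last by rewrite addr0.
rewrite [X in _ + X]/edge_turns big1 ?addr0 // => -[[|m] lt_m] _ //.
by rewrite /half_turn /step /= onth_default.
Qed.

Lemma rotation_out (k : nat) : (size (passes w) < k)%N -> rotation w k = 0.
Proof.
move=> lt_k; rewrite /rotation -/(edge_turns w (trace w) k) edge_turns_out ?div0z //.
by rewrite count_passes.
Qed.

(** A half-turn is made exactly when the direction changes between up and
    down. *)
Lemma half_turn_parity (x : strand_point) : exists z : int,
  half_turn w x = (~~ (step w x).2)%:Z - (~~ x.2)%:Z + z * 2.
Proof.
rewrite /half_turn; case: (step w x) => [[h' q'] up']; case: x => [[h q] up] /=.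
case: up up' => [] []; rewrite /=; first by exists 0.
- by case: ifP => _; [exists 0 | exists (-1)].
- by case: ifP => _; [exists 1 | exists 0].
- by exists 0.
Qed.

Lemma half_turn_pass (x : strand_point) : isSome (crossing_pass w x) -> half_turn w x = 0.
Proof.
case: x => [[h q] up]; rewrite /crossing_pass /half_turn /step.
case: (slice_ahead w _) => [[[||b] p]|] // _.
by rewrite (_ : (if up then _ else _) = (Cross b, p)) /= ?addbF ?eqxx; case: up.
Qed.

(** The knot starts upwards, and it is again upwards at the end of the first
    edge, be it at a crossing or at the exit. In the induction, the correction
    term accounts for remainders of the edge that start downwards. *)
Lemma first_edge_even : exists z : int, edge_turns w (trace w) 0 = z * 2.
Proof.
suff even n x : (forall y, y \in traject (step w) x n.+1 -> isSome (crossing_pass w y) -> y.2) ->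
    (iter n (step w) x).2 -> half_turn w (iter n (step w) x) = 0 ->
    exists z : int, edge_turns w (traject (step w) x n.+1) 0 = z * 2 - (~~ x.2)%:Z.
  have := even (sumn (widths w)).-1 start; rewrite prednK //.
  rewrite -/(trace w) (last_visit up_w).
  have turn0 : half_turn w (size w, 0%N, true) = 0.
    by rewrite /half_turn /step /= onth_default.
  move=> /(_ (passes_upwards up_w) isT turn0)[z ->].
  by exists z; rewrite subr0.
have edge_turns1 y : edge_turns w [:: y] 0 = half_turn w y.
  by rewrite /edge_turns big_mkcond big_ord1.
elim: n x => [|n IHn] x upw up_n turn_n.
  by exists 0; rewrite edge_turns1 /= in turn_n *; rewrite up_n turn_n.
rewrite iterSr in up_n turn_n.
have [z step_z] := IHn (step w x)
  (fun y in_y => upw y (mem_behead (s := traject _ x n.+2) in_y)) up_n turn_n.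
rewrite trajectS -cat1s edge_turns_cat edge_turns1.
rewrite [count _ _]/= addn0; case pass_x: (isSome (crossing_pass w x)).
  by exists 0; rewrite half_turn_pass // upw // ?mem_head.
have [z' ->] := half_turn_parity x.
by exists (z + z'); rewrite /= step_z; ring.
Qed.

End Upright.

Section Stacking.
Variables (w1 w2 : diagram) (up1 : upright w1) (up2 : upright w2).

(** Only on the merged edge do both terms contribute. There the halves of
    two numbers are added, which is correct because one of them is
    even. *)
Lemma rotation_cat (k : nat) : rotation (w1 ++ w2) k = rotation w1 k
  + (if (size (passes w1) <= k)%N then rotation w2 (k - size (passes w1)) else 0).
Proof.
have turns : edge_turns (w1 ++ w2) (trace (w1 ++ w2)) k = edge_turns w1 (trace w1) k
  + (if (size (passes w1) <= k)%N then edge_turns w2 (trace w2) (k - size (passes w1)) else 0).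
  rewrite trace_cat // edge_turns_cat.
  have same_pass x : x \in ascent w1 ->
      isSome (crossing_pass (w1 ++ w2) x) = isSome (crossing_pass w1 x).
    by move/(ascent_ahead up1)=> ahead; rewrite crossing_pass_catl.
  rewrite (_ : count _ _ = size (passes w1)); last first.
    by rewrite -count_ascent //; apply: eq_in_count => x /same_pass.
  rewrite edge_turns_ascent //; congr (_ + _).
    rewrite -[in LHS](map_id (ascent w1)); apply: edge_turns_map => // x /(ascent_ahead up1).
    exact: half_turn_catl.
  case: ifP => // _; apply: edge_turns_map => x /(trace_above_floor up2) above.
    by rewrite crossing_pass_catr //; case: crossing_pass.
  exact: half_turn_catr.
rewrite /rotation -/(edge_turns (w1 ++ w2) (trace (w1 ++ w2)) k) turns.
rewrite -/(edge_turns w1 (trace w1) k) -/(edge_turns w2 (trace w2) (k - size (passes w1))).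
case: ltngtP => [lt_k|gt_k|<-]; rewrite ?addr0 //.
  by rewrite edge_turns_out ?count_passes // add0r div0z add0r.
rewrite subnn; have [z ->] := first_edge_even up2.
by rewrite addrC divzMDl // mulzK // addrC.
Qed.

End Stacking.

(** * Nonvanishing by values at T = 1 *)

(** Asked over the integers, where the Alexander polynomials have their
    coefficients; this is transcendence over the prime field,
    together with characteristic 0. *)
Definition transcendental (F : fieldType) (t : F) : Prop :=
  forall P : {poly int}, P != 0 -> (map_poly intr P).[t] != 0.

Lemma transcendental_neq0 (F : fieldType) (t : F) : transcendental t -> t != 0.
Proof. by move/(_ 'X); rewrite polyX_eq0 map_polyX hornerX => /(_ isT). Qed.

(** [f] is a Laurent polynomial in [t] with integer coefficients whose value at
    [t = 1] is [z]. As a relation it spares a ring of such Laurent polynomials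
    inside [F], and it suffices for showing that determinants do not vanish. *)
Definition value_at_1 (F : fieldType) (t f : F) (z : int) : Prop :=
  exists2 p : laurent, laurent_eval p t = f & p.1.[1] = z.

Section ValueAt1.
Variables (F : fieldType) (t : F) (t_tr : transcendental t).
Let t_neq0 : t != 0 := transcendental_neq0 t_tr.

Lemma value_at_1_neq0 (f : F) (z : int) : value_at_1 t f z -> z != 0 -> f != 0.
Proof.
case=> -[P k] <- /= <- P1; rewrite /laurent_eval mulf_neq0 ?invr_eq0 ?expf_neq0 //=.
by apply: t_tr; apply: contraNneq P1 => ->; rewrite horner0.
Qed.

Lemma value_at_1_int (z : int) : value_at_1 t z%:~R z.
Proof.
by exists (z%:P, 0%N); rewrite /laurent_eval /= ?map_polyC ?hornerC ?divr1.
Qed.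

Lemma value_at_1_add (f g : F) (y z : int) :
  value_at_1 t f y -> value_at_1 t g z -> value_at_1 t (f + g) (y + z).
Proof.
move=> [[P k] <- /= <-] [[Q l] <- /= <-]; exists (P * 'X^l + Q * 'X^k, (k + l)%N).
  rewrite /laurent_eval /= rmorphD !rmorphM /= !map_polyXn !hornerE exprD.
  by field; rewrite !expf_neq0.
by rewrite !hornerE !expr1n !mulr1.
Qed.

Lemma value_at_1_mul (f g : F) (y z : int) :
  value_at_1 t f y -> value_at_1 t g z -> value_at_1 t (f * g) (y * z).
Proof.
move=> [[P k] <- /= <-] [[Q l] <- /= <-]; exists (P * Q, (k + l)%N).
  by rewrite /laurent_eval /= !rmorphM /= hornerM exprD invfM mulrACA.
by rewrite hornerM.
Qed.

Lemma value_at_1_sub (f g : F) (y z : int) :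
  value_at_1 t f y -> value_at_1 t g z -> value_at_1 t (f - g) (y - z).
Proof.
move=> f_y g_z; rewrite -mulN1r -[- z]mulN1r -[-1 : F]/((-1)%:~R).
by apply: value_at_1_add f_y (value_at_1_mul (value_at_1_int _) g_z).
Qed.

Lemma value_at_1_exp (s : int) : value_at_1 t (t ^ s) 1.
Proof.
case: s => n.
  by exists ('X^n, 0%N); rewrite /laurent_eval /= ?map_polyXn ?hornerXn ?expr1n ?divr1.
exists (1, n.+1); rewrite /laurent_eval /= ?hornerC // rmorph1 hornerC mul1r.
by rewrite NegzE exprnN.
Qed.

Lemma value_at_1_sum (I : Type) (r : seq I) (f : I -> F) (z : I -> int) :
  (forall i, value_at_1 t (f i) (z i)) ->
  value_at_1 t (\sum_(i <- r) f i) (\sum_(i <- r) z i).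
Proof.
move=> f_z; apply: (big_ind2 (value_at_1 t)) => //; first exact: (value_at_1_int 0).
by move=> *; apply: value_at_1_add.
Qed.

Lemma value_at_1_det (n : nat) (A : 'M[F]_n) (B : 'M[int]_n) :
  (forall i j, value_at_1 t (A i j) (B i j)) -> value_at_1 t (\det A) (\det B).
Proof.
move=> A_B; rewrite /determinant; apply: value_at_1_sum => s; apply: value_at_1_mul.
  have := value_at_1_int ((-1) ^+ perm.odd_perm s).
  by rewrite rmorphXn /= rmorphN1.
apply: (big_ind2 (value_at_1 t)) => //; first exact: (value_at_1_int 1).
by move=> *; apply: value_at_1_mul.
Qed.

End ValueAt1.

(** * The traffic function *)

(** The part of the traffic that goes from edge [a] on to edge [b], where
    [weight s] is the share that stays on the over-strand at a crossing of
    sign [s]. It is indexed by natural numbers so that diagrams of different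
    sizes can be compared without casts, and the weight is abstract so that
    [T = 1] can be substituted. *)
Definition flow (F : nzRingType) (weight : int -> F) (cs : seq crossing) (a b : nat) : F :=
  \sum_(c <- cs) let: (s, i, j) := c in
    (a == i)%:R * (weight s * (b == i.+1)%:R + (1 - weight s) * (b == j.+1)%:R)
    + (a == j)%:R * (b == j.+1)%:R.

Lemma traffic_matrixE (cs : seq crossing) (t : QT) (a b : 'I_((size cs).*2.+1)) :
  traffic_matrix cs t a b = (a == b :> nat)%:R - flow (exprz t) cs a b.
Proof. by rewrite mxE; congr (_ - _); apply: eq_bigr => -[[s i] j]. Qed.

Lemma det_unitriangular (R : comNzRingType) (n : nat) (f : nat -> nat -> R) :
  (forall a, f a a = 1) -> (forall a b, (b < a)%N -> f a b = 0) ->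
  \det (\matrix_(a < n, b < n) f a b) = 1.
Proof.
move=> f1 f0; rewrite -det_tr det_trig; first by rewrite big1 // => a _; rewrite !mxE f1.
apply/is_trig_mxP => a b lt_ab; rewrite !mxE; exact: f0.
Qed.

(** At [T = 1] nothing falls from the over-strand to the under-strand, so all
    traffic goes from an edge to the next one. *)
Lemma det_flow_at_1 (cs : seq crossing) (n : nat) :
  \det (\matrix_(a < n, b < n) ((a == b :> nat)%:R - flow (fun=> 1) cs a b)) = 1 :> int.
Proof.
have flow0 a b : (b <= a)%N -> flow (fun=> 1) cs a b = 0 :> int.
  move=> le_ba; rewrite /flow big1 // => -[[s i] j] _; rewrite subrr mul0r addr0 mul1r.
  have no_edge k : (a == k)%:R * (b == k.+1)%:R = 0 :> int.
    case: eqP => [a_k|_]; last by rewrite mul0r.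
    by rewrite mul1r ltn_eqF // ltnS -a_k.
  by rewrite !no_edge addr0.
apply: (@det_unitriangular _ n (fun a b => (a == b)%:R - flow (fun=> 1) cs a b)) => [a|a b lt_ba].
  by rewrite eqxx flow0 // subr0.
by rewrite gtn_eqF // flow0 ?subr0 // ltnW.
Qed.

Lemma traffic_matrix_unit (cs : seq crossing) (t : QT) :
  transcendental t -> traffic_matrix cs t \in unitmx.
Proof.
move=> t_tr.
rewrite unitmxE unitfE.
pose B : 'M[int]_((size cs).*2.+1) :=
  \matrix_(a, b) ((a == b :> nat)%:R - flow (fun=> 1) cs a b).
suff A_B a b : value_at_1 t (traffic_matrix cs t a b) (B a b).
  by apply: (value_at_1_neq0 t_tr (value_at_1_det t_tr A_B)); rewrite det_flow_at_1.
rewrite traffic_matrixE mxE.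
have nat_value n : value_at_1 t n%:R n%:R.
  by have := value_at_1_int t n; rewrite -[in X in value_at_1 _ _ X]natz.
apply: (value_at_1_sub t_tr (nat_value _)).
apply: (value_at_1_sum t_tr) => -[[s i] j].
have exp_value := value_at_1_exp t s.
have sub_value : value_at_1 t (1 - t ^ s) (1 - 1) by apply: (value_at_1_sub t_tr (nat_value 1%N)).
by do ![exact: nat_value | exact: exp_value | exact: sub_value
  | apply: (value_at_1_add t_tr) | apply: value_at_1_mul].
Qed.

Section Traffic.
Variables (cs : seq crossing) (t : QT) (t_tr : transcendental t).
Local Notation N := (size cs).*2.+1.

Lemma traffic_ord (a b : 'I_N) : traffic cs t a b = invmx (traffic_matrix cs t) a b.
Proof. by rewrite /traffic !inord_val. Qed.

Lemma traffic_system (a b : nat) : (a < N)%N -> (b < N)%N ->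
  \sum_(e < N) ((a == e)%:R - flow (exprz t) cs a e) * traffic cs t e b = (a == b)%:R.
Proof.
move=> lt_a lt_b.
have /matrixP/(_ (Ordinal lt_a) (Ordinal lt_b)) := mulmxV (traffic_matrix_unit cs t_tr).
rewrite [LHS]mxE [RHS]mxE -val_eqE => <-; apply: eq_bigr => e _.
by rewrite traffic_matrixE -traffic_ord.
Qed.

Lemma traffic_unique (v r : nat -> QT) :
  (forall a, (a < N)%N ->
     \sum_(e < N) ((a == e)%:R - flow (exprz t) cs a e) * v e = r a) ->
  forall e, (e < N)%N -> v e = \sum_(b < N) traffic cs t e b * r b.
Proof.
move=> solves e lt_e.
pose col (f : nat -> QT) : 'cV[QT]_N := \col_a f a.
have Av : traffic_matrix cs t *m col v = col r.
  apply/matrixP => a k; rewrite !mxE -solves //.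
  by apply: eq_bigr => e' _; rewrite traffic_matrixE mxE.
have /matrixP/(_ (Ordinal lt_e) ord0) := mulKmx (traffic_matrix_unit cs t_tr) (col v).
rewrite Av [LHS]mxE [RHS]mxE => <-; apply: eq_bigr => b _.
by rewrite mxE -traffic_ord.
Qed.

(** No crossing sends traffic to the first edge, so the first column of the
    traffic matrix is that of the identity. *)
Lemma traffic_first : traffic cs t 0 0 = 1.
Proof.
have flow0 a : flow (exprz t) cs a 0 = 0.
  by rewrite /flow big1 // => -[[s i] j] _; rewrite /= !mulr0 !addr0 mulr0.
have /matrixP/(_ ord0 ord0) := mulVmx (traffic_matrix_unit cs t_tr).
rewrite [LHS]mxE [RHS]mxE (bigD1 ord0) //= traffic_matrixE flow0 subr0 mulr1 big1 => [|e e0].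
  by rewrite addr0 -traffic_ord.
by rewrite traffic_matrixE flow0 subr0 -val_eqE /= in e0 *; rewrite (negPf e0) mulr0.
Qed.

End Traffic.

(** * Traffic on a stacked diagram *)

Definition labels_bounded (cs : seq crossing) : Prop :=
  forall s i j, (s, i, j) \in cs -> (i < (size cs).*2)%N /\ (j < (size cs).*2)%N.

Section Stacking.
Variables (cs1 cs2 : seq crossing) (t : QT) (t_tr : transcendental t).
Hypothesis bounded1 : labels_bounded cs1.
Local Notation M := (size cs1).*2.
Local Notation N2 := (size cs2).*2.+1.
Local Notation cs := (cs1 ++ map (shift_labels M) cs2).

Lemma flow_above (weight : int -> QT) (a b : nat) : (M <= a)%N || (M < b)%N ->
  flow weight cs1 a b = 0.
Proof.
move=> above; rewrite /flow big_seq big1 // => -[[s i] j] /bounded1[lt_i lt_j].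
case/orP: above => gt_M; first by rewrite [a == i]gtn_eqF ?[a == j]gtn_eqF ?mul0r ?addr0 //; lia.
by rewrite [b == i.+1]gtn_eqF ?[b == j.+1]gtn_eqF ?mulr0 ?addr0 ?mulr0 //; lia.
Qed.

Lemma flow_cat_l (weight : int -> QT) (a b : nat) : (a < M)%N ->
  flow weight cs a b = flow weight cs1 a b.
Proof.
move=> lt_a; rewrite /flow big_cat big_map /= [X in _ + X]big1 ?addr0 // => -[[s i] j] _ /=.
by rewrite [a == _]ltn_eqF ?[a == (M + j)%N]ltn_eqF ?mul0r ?addr0 //; lia.
Qed.

Lemma flow_cat_r (weight : int -> QT) (a b : nat) :
  flow weight cs (M + a)%N (M + b)%N = flow weight cs2 a b.
Proof.
rewrite [LHS]/flow big_cat -/(flow weight cs1 _ _) flow_above ?leq_addr //= add0r big_map.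
by apply: eq_bigr => -[[s i] j] _ /=; rewrite -!addnS !eqn_add2l.
Qed.

Lemma flow_cat_lr (weight : int -> QT) (a b : nat) : (b < M)%N ->
  flow weight cs (M + a)%N b = 0.
Proof.
move=> lt_b; rewrite /flow big_cat -/(flow weight cs1 _ _) flow_above ?leq_addr //= add0r.
rewrite big_map big1 // => -[[s i] j] _ /=.
by rewrite [b == _]ltn_eqF ?[b == (M + j).+1]ltn_eqF ?mulr0 ?addr0 ?mulr0 //; lia.
Qed.

Let sizeE : (size cs).*2.+1 = (M + N2)%N.
Proof. by rewrite size_cat size_map doubleD addnS. Qed.

Lemma upper_system (a b : nat) : (a < N2)%N -> (b < M + N2)%N ->
  \sum_(e < N2) ((a == e)%:R - flow (exprz t) cs2 a e) * traffic cs t (M + e)%N b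
  = ((M + a)%N == b)%:R.
Proof.
move=> lt_a lt_b; rewrite -(@traffic_system cs t t_tr (M + a)%N b) ?sizeE ?ltn_add2l //.
rewrite big_split_ord /= [X in _ = X + _]big1 ?add0r => [|e _].
  by apply: eq_bigr => e _; rewrite flow_cat_r eqn_add2l.
by rewrite flow_cat_lr // gtn_eqF ?subr0 ?mul0r // ltn_addr.
Qed.

(** Above the junction, the equations of the stacked diagram are those of the
    upper part. *)
Lemma traffic_cat_r (a b : nat) : (a < N2)%N -> (b < N2)%N ->
  traffic cs t (M + a)%N (M + b)%N = traffic cs2 t a b.
Proof.
move=> lt_a lt_b.
pose v e := traffic cs t (M + e)%N (M + b)%N.
rewrite -/(v a) (@traffic_unique cs2 t t_tr v (fun e => (e == b)%:R)) //.
  rewrite (bigD1 (Ordinal lt_b)) //= eqxx mulr1 big1 ?addr0 // => e.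
  by rewrite -val_eqE /= => /negPf ->; rewrite mulr0.
by move=> e lt_e; rewrite upper_system ?ltn_add2l // eqn_add2l.
Qed.

(** These entries solve the homogeneous system of the upper part. *)
Lemma traffic_cat_rl (a b : nat) : (a < N2)%N -> (b < M)%N ->
  traffic cs t (M + a)%N b = 0.
Proof.
move=> lt_a lt_b; pose v e := traffic cs t (M + e)%N b.
rewrite -/(v a) (@traffic_unique cs2 t t_tr v (fun=> 0)) //.
  by rewrite big1 // => e _; rewrite mulr0.
by move=> e lt_e; rewrite upper_system ?ltn_addr // gtn_eqF // ltn_addr.
Qed.

(** The equations of the lower crossings involve the edges up to [M]. The
    equation of the last edge of the lower part also holds in the stacked
    diagram, since no traffic comes back from edge [M] to edge [b]. *)
Lemma traffic_cat_l (a b : nat) : (a < M)%N -> (b < M)%N ->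
  traffic cs t a b = traffic cs1 t a b.
Proof.
move=> lt_a lt_b; pose v e := traffic cs t e b.
rewrite -/(v a) (@traffic_unique cs1 t t_tr v (fun e => (e == b)%:R)); last exact: ltnW.
  have lt_b1 : (b < M.+1)%N by apply: ltnW.
  rewrite (bigD1 (Ordinal lt_b1)) //= eqxx mulr1 big1 ?addr0 // => e.
  by rewrite -val_eqE /= => /negPf ->; rewrite mulr0.
move=> e; rewrite ltnS leq_eqVlt => /predU1P[-> | lt_e].
  rewrite (gtn_eqF lt_b) big1 // => e' _; rewrite flow_above ?leqnn // subr0.
  case: eqP => [<-|_]; rewrite ?mul0r // /v.
  by have := @traffic_cat_rl 0%N b (ltn0Sn _) lt_b; rewrite addn0 => ->; rewrite mulr0.
rewrite -(@traffic_system cs t t_tr e b) ?sizeE; try lia.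
rewrite -addSnnS big_split_ord /= [X in _ = _ + X]big1 ?addr0 => [|e' _].
  by apply: eq_bigr => e' _; rewrite flow_cat_l.
rewrite flow_cat_l // flow_above ?ltn_eqF ?subr0 ?mul0r //; lia.
Qed.

End Stacking.

(** No crossing takes the last edge as incoming edge, so the last row of the
    traffic matrix is that of the identity. *)
Lemma traffic_last (cs : seq crossing) (t : QT) : transcendental t -> labels_bounded cs ->
  traffic cs t (size cs).*2 (size cs).*2 = 1.
Proof.
move=> t_tr bounded; set M := (size cs).*2.
have := @traffic_system cs t t_tr M M (ltnSn _) (ltnSn _).
rewrite eqxx (bigD1 ord_max) //= flow_above ?leqnn // eqxx subr0 mul1r big1 ?addr0 // => e.
rewrite -val_eqE /= eq_sym => /negPf e_max.
by rewrite flow_above ?leqnn // e_max subr0 mul0r.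
Qed.

(** * Alexander minors *)

(** The Alexander matrix indexed by natural numbers, so that diagrams of
    different sizes can be compared. *)
Definition fox (cs : seq crossing) (r e : nat) : {poly int} :=
  \sum_(c <- cs) let: (s, i, j) := c in
    let x k : {poly int} := (e == k)%:R in
    (r == i)%:R * (x i - x i.+1)
    + (r == j)%:R * (if s == 1 then (1 - 'X) * x i + 'X * x j.+1 - x j
                     else (1 - 'X) * x i + 'X * x j - x j.+1).

Definition alexander_minor (cs : seq crossing) : {poly int} :=
  \det (col' ord_max (alexander_matrix cs)).

Lemma alexander_minorE (cs : seq crossing) : alexander_minor cs
  = \det (\matrix_(r < (size cs).*2, e < (size cs).*2) fox cs r e).
Proof.
congr (\det _); apply/matrixP => r e; rewrite !mxE lift_max.
by apply: eq_bigr => -[[s i] j].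
Qed.

Lemma det_stacked (R : comNzRingType) (k m n : nat) (f : nat -> nat -> R) :
  k = (m + n)%N -> (forall a b, (b < m)%N -> f (m + a)%N b = 0) ->
  \det (\matrix_(i < k, j < k) f i j)
  = \det (\matrix_(i < m, j < m) f i j) * \det (\matrix_(i < n, j < n) f (m + i)%N (m + j)%N).
Proof.
move=> -> f0; set A := \matrix_(i, j) _.
rewrite -[A]submxK (_ : dlsubmx A = 0).
  by rewrite det_ublock; congr (_ * _); congr (\det _); apply/matrixP => i j; rewrite !mxE.
by apply/matrixP => i j; rewrite !mxE f0 ?(ltn_ord j).
Qed.

Lemma alexander_minor_cat (cs1 cs2 : seq crossing) : labels_bounded cs1 ->
  alexander_minor (cs1 ++ map (shift_labels (size cs1).*2) cs2)
  = alexander_minor cs1 * alexander_minor cs2.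
Proof.
set M := (size cs1).*2 => bounded1.
have fox_above r e : (M <= r)%N -> fox cs1 r e = 0.
  move=> le_r; rewrite /fox big_seq big1 // => -[[s i] j] /bounded1[lt_i lt_j].
  by rewrite [r == i]gtn_eqF ?[r == j]gtn_eqF ?mul0r ?addr0 //; apply: leq_trans le_r.
rewrite !alexander_minorE (@det_stacked _ _ M (size cs2).*2).
- congr (_ * _); congr (\det _); apply/matrixP => r e; rewrite !mxE /fox big_cat big_map /=.
    rewrite [X in _ + X]big1 ?addr0 // => -[[s i] j] _ /=.
    have neq l : (nat_of_ord r == M + l)%N = false by rewrite ltn_eqF // ltn_addr ?ltn_ord.
    by rewrite !neq !mul0r addr0.
  rewrite -/(fox cs1 _ _) fox_above ?leq_addr // add0r.
  by apply: eq_bigr => -[[s i] j] _ /=; rewrite -!addnS !eqn_add2l.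
- by rewrite size_cat size_map doubleD.
move=> a b lt_b; rewrite /fox big_cat -/(fox cs1 _ _) fox_above ?leq_addr //= add0r big_map.
rewrite big1 // => -[[s i] j] _ /=.
have neq l : (M <= l)%N -> (b == l) = false by move=> le_l; apply/ltn_eqF/(leq_trans lt_b).
by rewrite !neq -?addnS ?leq_addr // !mulr0 !subr0 !addr0 !mulr0 if_same mulr0 addr0.
Qed.

(** * Symmetric Laurent polynomials *)

Lemma laurent_evalE (F : fieldType) (p : laurent) (t : F) : t != 0 ->
  (size p.1 <= p.2.*2.+1)%N ->
  laurent_eval p t = \sum_(i < p.2.*2.+1) (p.1`_i)%:~R * t ^ (i%:Z - p.2%:Z).
Proof.
move=> t0 size_p; rewrite /laurent_eval (@horner_coef_wide _ p.2.*2.+1); last first.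
  by apply: leq_trans size_p; exact: size_poly.
rewrite mulr_suml; apply: eq_bigr => i _.
by rewrite coef_map -mulrA expfzDr // exprnN.
Qed.

Lemma laurent_eval_inv (F : fieldType) (p : laurent) (t : F) : t != 0 ->
  laurent_symmetric p -> laurent_eval p t^-1 = laurent_eval p t.
Proof.
move=> t0 [size_p sym_p]; rewrite !laurent_evalE ?invr_eq0 //.
rewrite (reindex_inj rev_ord_inj); apply: eq_bigr => i _ /=.
rewrite subSS -sym_p -1?ltnS // exprz_inv; congr (_ * t ^ _).
by have := ltn_ord i; lia.
Qed.

(** With [f] and [g] the values of the two Laurent polynomials, the equation reads
    [t ^+ A * f = t ^+ B * g] after comparing values at 1, which excludes the
    sign. By symmetry the same equation with [t^-1] for [t] holds for the same
    [f] and [g]. Together they give [t ^+ (2 * A) = t ^+ (2 * B)], so [A = B]. *)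
Lemma symmetric_unique (F : fieldType) (t : F) (p q : laurent) (a b : nat) (neg : bool) :
  transcendental t ->
  laurent_eval q t^-1 = laurent_eval q t -> laurent_symmetric p ->
  p.1.[1] = 1 -> q.1.[1] = 1 -> 'X^a * p.1 = (-1) ^+ neg * 'X^b * q.1 ->
  laurent_eval p t = laurent_eval q t.
Proof.
move=> t_tr inv_q sym_p p1 q1 pq.
have t0 := transcendental_neq0 t_tr.
have inv_p := laurent_eval_inv t0 sym_p.
have neg0 : neg = false.
  move/(congr1 (horner^~ 1)): pq; rewrite !hornerM !hornerXn !expr1n p1 q1 !mulr1.
  by case: (neg) => //=; rewrite expr1 hornerN hornerC.
rewrite neg0 expr0 mul1r in pq.
have evals (u : F) : u != 0 ->
    u ^+ (a + p.2) * laurent_eval p u = u ^+ (b + q.2) * laurent_eval q u.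
  move=> u0; move/(congr1 (fun P => (map_poly intr P).[u])): pq.
  rewrite !rmorphM /= !hornerM !map_polyXn !hornerXn /laurent_eval !exprD => pq.
  rewrite -mulrA [u ^+ p.2 * _]mulrC mulfVK ?expf_neq0 // pq.
  by rewrite -mulrA [u ^+ q.2 * _]mulrC mulfVK ?expf_neq0.
have fg := evals t t0.
have gf := evals t^-1; rewrite invr_eq0 inv_p inv_q in gf; have {}gf := gf t0.
set A := (a + p.2)%N in fg gf; set B := (b + q.2)%N in fg gf.
clearbody A B.
set f := laurent_eval p t in fg gf *; set g := laurent_eval q t in fg gf *.
have {}gf : t ^+ B * f = t ^+ A * g.
  apply: (mulfI (x := t^-1 ^+ A * t^-1 ^+ B)).
    by rewrite mulf_neq0 ?expf_neq0 ?invr_eq0.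
  rewrite -mulrA [t^-1 ^+ B * _]mulrA -exprMn mulVf // expr1n mul1r gf.
  by rewrite [t^-1 ^+ A * _]mulrC -!mulrA [t^-1 ^+ A * _]mulrA -exprMn mulVf // expr1n mul1r.
have f0 : f != 0.
  rewrite mulf_neq0 ?invr_eq0 ?expf_neq0 // t_tr //.
  by apply: contra_eq_neq p1 => ->; rewrite horner0.
have tAB : (map_poly intr ('X^(A + A) - 'X^(B + B) : {poly int})).[t] = 0.
  rewrite rmorphB /= !map_polyXn hornerD hornerN !hornerXn; apply: (mulIf f0).
  by rewrite mul0r mulrBl !exprD -!mulrA fg gf mulrCA subrr.
have AB : A = B.
  apply/eqP; apply: contraPT tAB => neqAB; apply/eqP; apply: t_tr; rewrite subr_eq0.
  apply: contra neqAB => /eqP/(congr1 (fun P : {poly int} => size P)).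
  by rewrite !size_polyXn => -[]; rewrite !addnn => /double_inj ->.
by apply: (mulfI (x := t ^+ A)); rewrite ?expf_neq0 // -/f fg AB.
Qed.

(** * Transcendence of the three variables *)

Lemma nonroot_nat (P : {poly int}) : P != 0 -> exists n : nat, P.[n%:R] != 0.
Proof.
move=> P0; pose pts := [seq (n%:R : int) | n <- iota 0 (size P)].
have uniq_pts : uniq pts.
  by rewrite map_inj_uniq ?iota_uniq // => m n /eqP; rewrite eqr_nat => /eqP.
have /allPn[_ /mapP[n _ ->] Pn] : ~~ all (root P) pts; last by exists n.
apply/negP => roots; have := max_poly_roots P0 roots uniq_pts.
by rewrite size_map size_iota ltnn.
Qed.

(** A nonzero integer polynomial does not vanish at some natural number [n];
    specializing [m] to [n] shows that it does not vanish at [m] either. *)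
Lemma transcendental_tofrac (D : idomainType) (m : D) :
  (forall n : nat, exists phi : {rmorphism D -> rat}, phi m = n%:R) ->
  transcendental (FracField.tofrac m).
Proof.
move=> values P /nonroot_nat[n Pn]; have [phi phi_m] := values n.
have -> : (map_poly intr P).[FracField.tofrac m]
    = FracField.tofrac (map_poly intr P).[m].
  rewrite -horner_map -map_poly_comp; congr _.[_]; apply: eq_map_poly => z.
  by rewrite /= rmorph_int.
rewrite tofrac_eq0; apply: contraNneq Pn => Pm0.
have : phi (map_poly intr P).[m] = 0 by rewrite Pm0 rmorph0.
rewrite -horner_map -map_poly_comp phi_m (eq_map_poly (g := intr)) => [|z]; last first.
  by rewrite /= rmorph_int.
rewrite -(rmorph_nat (intr : int -> rat)) horner_map => /eqP.
by rewrite intr_eq0.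
Qed.

Definition specialize (t1 t2 : rat) : {rmorphism {poly {poly rat}} -> rat} :=
  horner_eval t1 \o horner_eval t2%:P.

Lemma T1_transcendental : transcendental T1.
Proof.
apply: transcendental_tofrac => n; exists (specialize n%:R 1).
by rewrite /= /horner_eval hornerC hornerX.
Qed.

Lemma T2_transcendental : transcendental T2.
Proof.
apply: transcendental_tofrac => n; exists (specialize 1 n%:R).
by rewrite /= /horner_eval hornerX hornerC.
Qed.

Lemma T3_transcendental : transcendental T3.
Proof.
rewrite /T3 /T1 /T2 -rmorphM; apply: transcendental_tofrac => n; exists (specialize n%:R 1).
by rewrite /= /horner_eval hornerM hornerC hornerX hornerM hornerX hornerC mulr1.
Qed.

(** * Multiplicativity of the normalization factor *)

Lemma laurent_eval_cat (F : fieldType) (t : F) (w1 w2 : diagram) (p1 p2 p : laurent) :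
  transcendental t -> upright w1 -> upright w2 ->
  symmetric_alexander w1 p1 -> symmetric_alexander w2 p2 ->
  symmetric_alexander (w1 ++ w2) p ->
  laurent_eval p t = laurent_eval p1 t * laurent_eval p2 t.
Proof.
move=> t_tr up1 up2 [sym1 one1 [a1 [b1 [n1 D1]]]] [sym2 one2 [a2 [b2 [n2 D2]]]].
move=> [sym one [a [b [n D]]]].
have t0 := transcendental_neq0 t_tr.
pose q : laurent := (p1.1 * p2.1, (p1.2 + p2.2)%N).
have evalM u : laurent_eval q u = laurent_eval p1 u * laurent_eval p2 u.
  by rewrite /laurent_eval rmorphM hornerM exprD invfM mulrACA.
rewrite -evalM.
apply: (@symmetric_unique _ t p q (a + b1 + b2) (b + a1 + a2) (n (+) n1 (+) n2)) => //.
- by rewrite !evalM !laurent_eval_inv.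
- by rewrite hornerM one1 one2.
move: D D1 D2; rewrite -!/(alexander_minor _) crossings_cat //.
rewrite alexander_minor_cat; last by move=> s i j; apply: crossing_labels_lt.
move: (alexander_minor (crossings w1)) (alexander_minor (crossings w2)) => m1 m2 D D1 D2.
have sgn (k : bool) : (-1) ^+ k * (-1) ^+ k = 1 :> {poly int} by rewrite -signr_addb addbb.
have -> : 'X^(a + b1 + b2) * p.1
    = (-1) ^+ n * 'X^b * (('X^b1 * m1) * ('X^b2 * m2)).
  by rewrite !exprD; transitivity ('X^b1 * 'X^b2 * ('X^a * p.1)); [|rewrite D]; ring.
have -> : 'X^b1 * m1 = (-1) ^+ n1 * ('X^a1 * p1.1).
  by rewrite D1 -mulrA [RHS]mulrA sgn mul1r.
have -> : 'X^b2 * m2 = (-1) ^+ n2 * ('X^a2 * p2.1).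
  by rewrite D2 -mulrA [RHS]mulrA sgn mul1r.
by rewrite !signr_addb !exprD /=; ring.
Qed.

Lemma norm_factor_cat (w1 w2 : diagram) (p1 p2 p : laurent) :
  upright w1 -> upright w2 ->
  symmetric_alexander w1 p1 -> symmetric_alexander w2 p2 ->
  symmetric_alexander (w1 ++ w2) p ->
  norm_factor p = norm_factor p1 * norm_factor p2.
Proof.
move=> up1 up2 sym1 sym2 sym.
rewrite /norm_factor !(laurent_eval_cat _ up1 up2 sym1 sym2 sym); first by rewrite !mulrA; ring.
- exact: T3_transcendental.
- exact: T2_transcendental.
- exact: T1_transcendental.
Qed.

(** * Additivity of the state sum *)

Section ShiftedLabels.
Variables (g1 g2 g3 g1' g2' g3' : nat -> nat -> QT) (d N : nat).
Hypothesis eq1 : forall a b, (a < N)%N -> (b < N)%N -> g1 (d + a)%N (d + b)%N = g1' a b.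
Hypothesis eq2 : forall a b, (a < N)%N -> (b < N)%N -> g2 (d + a)%N (d + b)%N = g2' a b.
Hypothesis eq3 : forall a b, (a < N)%N -> (b < N)%N -> g3 (d + a)%N (d + b)%N = g3' a b.

(** The state sum sees the labels only through the traffic functions. *)
Lemma F1_shift (s : int) (i j : nat) : (i < N)%N -> (j < N)%N ->
  F1 g1 g2 g3 (s, (d + i)%N, (d + j)%N) = F1 g1' g2' g3' (s, i, j).
Proof. by move=> lt_i lt_j; rewrite /F1 !eq1 // !eq2 // !eq3. Qed.

Lemma F2_shift (s0 s1 : int) (i0 j0 i1 j1 : nat) :
  (i0 < N)%N -> (j0 < N)%N -> (i1 < N)%N -> (j1 < N)%N ->
  F2 g1 g2 g3 (s0, (d + i0)%N, (d + j0)%N) (s1, (d + i1)%N, (d + j1)%N)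
  = F2 g1' g2' g3' (s0, i0, j0) (s1, i1, j1).
Proof. by move=> ? ? ? ?; rewrite /F2 !eq1 // !eq2 // !eq3. Qed.

End ShiftedLabels.

Section Stacking.
Variables (w1 w2 : diagram) (up1 : upright w1) (up2 : upright w2).
Local Notation cs1 := (crossings w1).
Local Notation cs2 := (crossings w2).
Local Notation M := (size cs1).*2.
Local Notation N2 := (size cs2).*2.+1.
Local Notation cs := (cs1 ++ map (shift_labels M) cs2).

Let bounded1 : labels_bounded cs1.
Proof. by move=> s i j; apply: crossing_labels_lt. Qed.

Let bounded2 s i j : (s, i, j) \in cs2 -> (i < N2)%N /\ (j < N2)%N.
Proof. by case/(crossing_labels_lt up2) => lt_i lt_j; split; apply: ltnW. Qed.

Lemma sum_F1_cat :
  \sum_(c <- cs) F1 (traffic cs T1) (traffic cs T2) (traffic cs T3) c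
  = \sum_(c <- cs1) F1 (traffic cs1 T1) (traffic cs1 T2) (traffic cs1 T3) c
  + \sum_(c <- cs2) F1 (traffic cs2 T1) (traffic cs2 T2) (traffic cs2 T3) c.
Proof.
rewrite big_cat big_map /=; congr (_ + _); apply: eq_big_seq => -[[s i] j].
  case/bounded1; apply: (F1_shift (d := 0)) => a b lt_a lt_b;
  apply: traffic_cat_l => //;
  [exact: T1_transcendental | exact: T2_transcendental | exact: T3_transcendental].
case/bounded2; apply: F1_shift => a b lt_a lt_b; apply: traffic_cat_r => //;
[exact: T1_transcendental | exact: T2_transcendental | exact: T3_transcendental].
Qed.

(** For a pair of crossings from different parts, one of the factors
    [g1 j1 i0] and [g3 j0 i1] is traffic from the upper to the lower part. *)
Lemma sum_F2_cat :
  \sum_(c0 <- cs) \sum_(c1 <- cs) F2 (traffic cs T1) (traffic cs T2) (traffic cs T3) c0 c1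
  = \sum_(c0 <- cs1) \sum_(c1 <- cs1)
      F2 (traffic cs1 T1) (traffic cs1 T2) (traffic cs1 T3) c0 c1
  + \sum_(c0 <- cs2) \sum_(c1 <- cs2)
      F2 (traffic cs2 T1) (traffic cs2 T2) (traffic cs2 T3) c0 c1.
Proof.
rewrite big_cat big_map /=; congr (_ + _); apply: eq_big_seq => -[[s0 i0] j0].
  case/bounded1=> lt_i0 lt_j0; rewrite big_cat /= [X in _ + X]big1_seq ?addr0.
    apply: eq_big_seq => -[[s1 i1] j1] /bounded1[lt_i1 lt_j1].
    apply: (F2_shift (d := 0)) lt_i0 lt_j0 lt_i1 lt_j1 => a b lt_a lt_b;
    apply: traffic_cat_l => //;
    [exact: T1_transcendental | exact: T2_transcendental | exact: T3_transcendental].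
  move=> _ /mapP[[[s1 i1] j1] /bounded2[lt_i1 lt_j1] ->]; rewrite /F2 /shift_labels.
  rewrite (traffic_cat_rl T1_transcendental bounded1 lt_j1 lt_i0).
  by rewrite !(mulr0, mul0r).
case/bounded2=> lt_i0 lt_j0; rewrite big_cat /= big1_seq ?add0r ?big_map.
  apply: eq_big_seq => -[[s1 i1] j1] /bounded2[lt_i1 lt_j1].
  apply: F2_shift lt_i0 lt_j0 lt_i1 lt_j1 => a b lt_a lt_b; apply: traffic_cat_r => //;
  [exact: T1_transcendental | exact: T2_transcendental | exact: T3_transcendental].
move=> [[s1 i1] j1] /bounded1[lt_i1 lt_j1]; rewrite /F2 /shift_labels.
rewrite (traffic_cat_rl T3_transcendental bounded1 lt_j0 lt_i1).
by rewrite !(mulr0, mul0r).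
Qed.

(** The rotation number of the merged edge [M] is shared between both sums; this
    is consistent since the traffic from this edge to itself is 1 in the
    stacked diagram, as it is for the last edge of the lower part and for the
    first edge of the upper part. *)
Lemma sum_F3_cat :
  \sum_(k < (size cs).*2.+1) F3 (traffic cs T3) (rotation (w1 ++ w2) k) k
  = \sum_(k < M.+1) F3 (traffic cs1 T3) (rotation w1 k) k
  + \sum_(k < N2) F3 (traffic cs2 T3) (rotation w2 k) k.
Proof.
have tr3 := T3_transcendental.
pose rot2 k := if (M <= k)%N then rotation w2 (k - M) else 0.
have F3D k : F3 (traffic cs T3) (rotation (w1 ++ w2) k) k
    = F3 (traffic cs T3) (rotation w1 k) k + F3 (traffic cs T3) (rot2 k) k.
  by rewrite rotation_cat // size_passes // /F3 -mulrDl -intrD.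
under eq_bigr => k _ do rewrite F3D.
have sizeE : (size cs).*2.+1 = (M + N2)%N by rewrite size_cat size_map doubleD addnS.
rewrite big_split /= sizeE; congr (_ + _).
  rewrite -addSnnS big_split_ord /= [X in _ + X]big1 ?addr0 => [|k _]; last first.
    by rewrite rotation_out ?size_passes ?ltn_addr // /F3 mul0r.
  apply: eq_bigr => k _; rewrite /F3; congr (_ * (_ - _)).
  have := ltn_ord k; rewrite ltnS leq_eqVlt => /predU1P[-> | lt_k]; last exact: traffic_cat_l.
  rewrite traffic_last //; have := @traffic_cat_r cs1 cs2 T3 tr3 bounded1 0 0 isT isT.
  by rewrite addn0 traffic_first // => ->.
rewrite big_split_ord /= big1 ?add0r => [|k _].
  apply: eq_bigr => k _; rewrite /F3 /rot2 leq_addr addKn traffic_cat_r //.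
by rewrite /rot2 leqNgt ltn_ord /F3 mul0r.
Qed.

Lemma state_sum_cat : state_sum (w1 ++ w2) = state_sum w1 + state_sum w2.
Proof.
rewrite /state_sum crossings_cat // sum_F1_cat sum_F2_cat sum_F3_cat.
by rewrite !addrA; ring.
Qed.

End Stacking.

Theorem theorem3p2 (R : realType)
    (Delta : knot R -> laurent) (theta : knot R -> QT)
    (Delta_alexander : is_alexander_invariant Delta)
    (theta_invariant : is_theta_invariant Delta theta)
    (K1 K2 K : knot R) (K_sum : is_connected_sum K1 K2 K) :
  theta K = norm_factor (Delta K2) * theta K1
          + norm_factor (Delta K1) * theta K2.
Proof.
have [w1 [w2 [rep1 rep2 rep]]] := K_sum; have [up1 _] := rep1; have [up2 _] := rep2.
rewrite (theta_invariant _ _ rep1) (theta_invariant _ _ rep2) (theta_invariant _ _ rep).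
rewrite (norm_factor_cat up1 up2 (Delta_alexander _ _ rep1) (Delta_alexander _ _ rep2)
  (Delta_alexander _ _ rep)).
by rewrite state_sum_cat // mulrDr mulrA [X in _ * _ + X]mulrA [X in X * _]mulrC.
Qed.
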